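(* Let $A=\frac{\alpha}{a}$ and $B=\frac{\beta}{b}$ be rationals of $[0,1]$ (in reduced form, $a,b\ge 1$) which are Farey neighbors, such that $Q=\frac{p}{q}$ lies strictly between $A$ and $B$, at most one of $A,B$ is a Farey neighbor of $Q$, and at most one of $A,B$ is a Farey neighbor of $\infty=\frac10$ (i.e. at most one of $A,B$ belongs to $\{0,1\}$). Then $x_0,x_a,x_b,x_{a+b}$ span a top-dimensional cell of the boundary of the convex hull $\Pi$, and this cell is a (non-degenerate) tetrahedron; that is, the convex hull of $\{x_0,x_a,x_b,x_{a+b}\}$ is a $3$-dimensional face of $\Pi$.
   Context: Fix integers $q\ge 5$ and $p\in\{2,\dots,q-2\}$ with $p$ coprime to $q$, and let $Q:=\frac pq\in(0,1)$. Identify $\mathbb{C}^2$ with $\mathbb{R}^4$ in the standard way. Let $\varphi:\mathbb{C}^2\to\mathbb{C}^2$, $\varphi(z,z')=(e^{2i\pi/q}z,\,e^{2ip\pi/q}z')$. Let $x_0=(1,1)\in\mathbb{C}^2$ and, for $k\in\mathbb{Z}$, $x_k=\varphi^k(x_0)$ (so $x_{k+q}=x_k$). Let $\Pi\subset\mathbb{R}^4$ be the convex hull of $\{x_0,\dots,x_{q-1}\}$; a top-dimensional cell (or face) of $\Pi$ is a $3$-dimensional face of this convex polytope. Two rationals $\frac us,\frac vt$ in reduced form (with $\infty=\frac10$ allowed) are called Farey neighbors if $|ut-vs|=1$. It is not assumed that $A<B$ or that $a<b$. *)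

(* Defs.v *)
From mathcomp Require Import all_boot all_order all_algebra.
From mathcomp Require Import classical_sets reals trigo convex.
From mathcomp Require Import complex.

Set Implicit Arguments.
Unset Strict Implicit.
Unset Printing Implicit Defensive.

Import Order.TTheory GRing.Theory Num.Theory.
Local Open Scope classical_set_scope.
Local Open Scope ring_scope.
Local Open Scope complex_scope.

(* u/s and v/t are meant in reduced form; infinity is encoded as 1/0. *)
Definition farey_neighbors (u s v t : int) : bool := `|u * t - v * s| == 1.

Definition strictly_between (x y z : rat) : bool := (y < x < z) || (z < x < y).

Definition expi {R : realType} (t : R) : R[i] := cos t +i* sin t.

Section Orbit.
Context {R : realType}.

Definition phi (p q : nat) (z : R[i] * R[i]) : R[i] * R[i] :=
  (expi (2 * pi / q%:R) * z.1, expi (2 * p%:R * pi / q%:R) * z.2).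

Definition real4 (z : R[i] * R[i]) : 'rV[R]_4 :=
  \row_(j < 4) [:: complex.Re z.1; complex.Im z.1; complex.Re z.2; complex.Im z.2]`_j.

(* Natural exponents suffice: phi p q has order q, so every x_k with k an
   integer is some x_k with k a natural number. *)
Definition x_ (p q k : nat) : 'rV[R]_4 := real4 (iter k (phi p q) (1, 1)).

End Orbit.

Section Polytopes.
Context {R : realType} {n : nat}.
Implicit Types (A P F : set 'rV[R]_n).

Definition conv_hull A : set 'rV[R]_n :=
  smallest (@convex_set R 'rV[R]_n) A.

Definition affinely_independent (d : nat) (v : 'I_d.+1 -> 'rV[R]_n) : bool :=
  row_free (\matrix_(i < d) (v (lift ord0 i) - v ord0)).

(* The affine dimension of F is d: d + 1 is the largest number of affinely
   independent points of F. *)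
Definition has_dim (d : nat) F : Prop :=
  (exists v : 'I_d.+1 -> 'rV[R]_n,
     (forall i, F (v i)) /\ affinely_independent v) /\
  ~ (exists v : 'I_d.+2 -> 'rV[R]_n,
     (forall i, F (v i)) /\ affinely_independent v).

(* F is the intersection of P with a supporting hyperplane {x | x . u = c};
   since u != 0, F lies in the boundary of P. *)
Definition is_face P F : Prop :=
  exists (u : 'cV[R]_n) (c : R),
    [/\ u != 0,
        forall x, P x -> (x *m u) 0 0 <= c &
        F = P `&` [set x | (x *m u) 0 0 = c]].

End Polytopes.

Definition Pi_ {R : realType} (p q : nat) : set 'rV[R]_4 :=
  conv_hull [set x_ p q k | k in [set k | (k < q)%N]].

(* Main.v *)
Require Import Defs.
From mathcomp Require Import all_boot all_order all_algebra.
From mathcomp Require Import classical_sets reals.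
From mathcomp Require Import interval_inference topology normedtype derive.
From mathcomp Require Import realfun trigo convex complex.
From mathcomp Require Import ring lra zify.
Import Order.TTheory GRing.Theory Num.Theory.
Import numFieldNormedType.Exports.
Local Open Scope classical_set_scope.
Local Open Scope ring_scope.

(** Put [a' = |p a - alpha q|] and [b' = |p b - beta q|]. Since [A] and [B] are
    Farey neighbors on either side of [p / q], the four positive integers
    satisfy [a b' + a' b = q]. Hence, for a sign [e], the vectors [(a, e a')]
    and [(b, - e b')] form a basis of the lattice of all [(X, Y)] with
    [Y = p X mod q], whose covolume is [q]. The orbit is the image of this
    lattice under [(X, Y) => (exp (2 i pi X / q), exp (2 i pi Y / q))], and
    [x_0, x_a, x_b, x_(a+b)] are the vertices of a fundamental parallelogram,
    centered at half the sum of the basis.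

    Write [r n = n pi / q]. The supporting functional takes on [x_k] the value
    [S cos X + T cos Y], where [(X, Y)] is now the angular position of [x_k]
    relative to the center, [S = sin (r a') sin (r b')] and
    [T = sin (r a) sin (r b)]. The lattice consists of the points
    [X = i r a + j r b, e Y = i r a' - j r b'] with [i] and [j] odd. The ratio
    of [S] to [T] makes the functional take one common value [M] at the four
    vertices, where [i] and [j] are [1] or [-1], and everything amounts to
    showing that [M] is exceeded nowhere and attained only there.

    The reason is convexity. As soon as [M > |S - T|], that is, as soon as [M]
    is above the saddle values of [S cos X + T cos Y], the region where this
    function is at least [M] in the square of side [2 pi] is strictly convex; in
    the form used here, it lies strictly on one side of the tangent of the level
    curve at each point ([tangent_lt]). The tangent at the vertex [i = j = 1]
    has the vertices [(1, -1)] and [(-1, 1)] strictly on the inner side, so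
    every other point with [i, j >= 1] lies beyond it ([superlevel_quadrant]).
    As [i] and [j] are odd, they are never [0], and the four quadrants cover all
    lattice points.

    The inequality [M > |S - T|] factors ([saddle_lt]) into four inequalities,
    of the kind [t a' t b' t a < t b], between the tangents
    [t n = tan (n pi / (2 q))]. If [a] and [b'] are at least [2], this one
    follows from [t a t b' < t 1 t (a b')], which holds because
    [tan (c x) / tan x] increases with [x], and from [a b' <= q - a'] and
    [t a' t (q - a') = 1] ([tan3_lt]). The four inequalities fail only when one
    of the pairs [(a, b)], [(a', b')], [(a, a')], [(b, b')] is [(1, 1)]. The
    hypotheses on the Farey neighbors of infinity and of [Q] exclude the first
    two pairs, and [2 <= p <= q - 2] the last two. *)

(** * The level curves of a weighted sum of two cosines *)

(** On the line [S u + T v = M] the difference of the two sides, divided by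
    [u - u0], is affine in [u] and in [u0] separately. The expansion in the
    barycentric coordinates of the segment cut out by [u <= 1] and [v <= 1]
    has coefficients which are positive because [M > |S - T|]. *)
Lemma cross_sqr_lt (R : realFieldType) (S T u0 v0 u v : R) :
  0 < S -> 0 < T -> `|S - T| < S * u0 + T * v0 ->
  u0 <= 1 -> v0 <= 1 -> u <= 1 -> v <= 1 -> u0 < u ->
  S * u + T * v = S * u0 + T * v0 ->
  (1 - v0 ^+ 2) * (1 - u ^+ 2) < (1 - u0 ^+ 2) * (1 - v ^+ 2).
Proof.
move=> S0 T0 hM u01 v01 u1 v1 u0u hL.
pose d := (u - u0) / T.
have d0 : 0 < d by rewrite divr_gt0// subr_gt0.
have eu : u = u0 + T * d by rewrite /d; field; rewrite gt_eqF.
have ev : v = v0 - S * d.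
  by apply: (mulfI (lt0r_neq0 T0)); rewrite mulrBr; move: hL; rewrite eu; lra.
set M := S * u0 + T * v0 in hM hL.
have /andP[m1 m2] : (0 < M + S - T) && (0 < M + T - S).
  by move: hM; rewrite ltr_norml => /andP[? ?]; apply/andP; split; lra.
have v0v : v < v0 by rewrite ev ltrBlDr ltrDl mulr_gt0.
have N0 : 0 < S + T - M.
  have : 0 < S * (1 - u0) by rewrite mulr_gt0// subr_gt0; lra.
  have : 0 <= T * (1 - v0) by rewrite mulr_ge0// ?subr_ge0// ltW.
  by rewrite /M; lra.
rewrite -subr_gt0.
pose E := T * (u + u0) + S * (v + v0) - M * (v0 * u + u0 * v).
rewrite (_ : _ - _ = d * E); last by rewrite /E /M eu ev; ring.
rewrite pmulr_rgt0// -(pmulr_lgt0 _ N0).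
pose P := 1 - u; pose Q := 1 - v; pose P0 := 1 - u0; pose Q0 := 1 - v0.
have -> : E * (S + T - M) = 2 * S * (M + S - T) * (P * P0)
   + 2 * T * (M + T - S) * (Q * Q0)
   + (M + S - T) * (M + T - S) * (P * Q0 + P0 * Q).
  by rewrite /E /P /Q /P0 /Q0 /M eu ev; ring.
have hP : 0 <= P by rewrite subr_ge0.
have hQ : 0 < Q by rewrite subr_gt0; lra.
have hP0 : 0 < P0 by rewrite subr_gt0; lra.
have hQ0 : 0 <= Q0 by rewrite subr_ge0.
apply: ltr_wpDl.
  by rewrite addr_ge0// !mulr_ge0// ltW.
by rewrite pmulr_rgt0 ?mulr_gt0// ltr_wpDl ?mulr_ge0 ?mulr_gt0.
Qed.

Lemma cos_ltE {R : realType} (x y : R) : 0 <= x <= pi -> 0 <= y <= pi ->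
  (cos x < cos y) = (y < x).
Proof. by move=> hx hy; rewrite ltr_cos// in_itv. Qed.

Lemma cos_leE {R : realType} (x y : R) : 0 <= x <= pi -> 0 <= y <= pi ->
  (cos x <= cos y) = (y <= x).
Proof. by move=> hx hy; rewrite !leNgt cos_ltE. Qed.

(** Along the level curve of [S cos x + T cos y], the ratio
    [sin x / sin y], to which the slope is proportional, is monotonic: this is
    the convexity of the region inside the curve. *)
Lemma sin_cross_lt {R : realType} (S T x0 y0 x y : R) :
  0 < S -> 0 < T -> `|S - T| < S * cos x0 + T * cos y0 ->
  0 <= x0 <= pi -> 0 <= y0 <= pi -> 0 <= x -> x < x0 -> 0 <= y <= pi ->
  S * cos x + T * cos y = S * cos x0 + T * cos y0 ->
  sin y0 * sin x < sin x0 * sin y.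
Proof.
move=> S0 T0 hM hx0 hy0 x_ge0 xx0 hy hL.
have hx : 0 <= x <= pi by lra.
have sx := sin_ge0_pi hx; have sy := sin_ge0_pi hy.
have sx0 := sin_ge0_pi hx0; have sy0 := sin_ge0_pi hy0.
rewrite -ltr_sqr ?nnegrE ?mulr_ge0// !exprMn !sin2cos2.
by apply: (@cross_sqr_lt _ S T) => //; rewrite ?cos_le1// cos_ltE.
Qed.

(** A point of the superlevel set that is left of and above [(x0, y0)] is below
    the tangent at [(x0, y0)]. The mean value theorem, applied to the level
    curve as a graph, replaces the chord by a tangent at an intermediate point,
    whose slope is compared by [sin_cross_lt]. *)
Lemma tangent_corner {R : realType} (S T x0 y0 x y : R) :
  0 < S -> 0 < T -> `|S - T| < S * cos x0 + T * cos y0 ->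
  x0 <= pi -> 0 <= y0 -> 0 <= x -> x < x0 -> y0 < y -> y <= pi ->
  S * cos x0 + T * cos y0 <= S * cos x + T * cos y ->
  T * sin y0 * (y - y0) < S * sin x0 * (x0 - x).
Proof.
move=> S0 T0 hM x0pi y0_ge0 x_ge0 xx0 y0y ypi hL.
have hx0 : 0 <= x0 <= pi by lra.
have hy0 : 0 <= y0 <= pi by lra.
have hy : 0 <= y <= pi by lra.
have Tn0 : T != 0 by rewrite gt_eqF.
set M := S * cos x0 + T * cos y0 in hM hL.
have /andP[m1 m2] : (0 < M + S - T) && (0 < M + T - S).
  by move: hM; rewrite ltr_norml => /andP[? ?]; apply/andP; split; lra.
have sx0 : 0 < sin x0.
  apply: sin_gt0_pi; rewrite (le_lt_trans x_ge0 xx0)/= lt_neqAle x0pi andbT.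
  apply/eqP => e; move: m1; rewrite /M e cospi.
  have : 0 <= T * (1 - cos y0) by rewrite mulr_ge0 ?subr_ge0 ?cos_le1// ltW.
  by lra.
have [y00|y00] := eqVneq y0 0.
  by rewrite y00 sin0 mulr0 mul0r !mulr_gt0// subr_gt0.
have y0_gt0 : 0 < y0 by rewrite lt_neqAle eq_sym y00.
have sy0 : 0 < sin y0 by apply: sin_gt0_pi; lra.
(* the level curve through (x0, y0), as a graph over the first coordinate *)
pose w (t : R) := T^-1 * (M - S * cos t).
pose h (t : R) := acos (w t).
have w_lt t : x <= t <= x0 -> -1 < w t < 1.
  move=> /andP[xt tx0].
  have c1 : S * cos x0 <= S * cos t by rewrite ler_wpM2l ?cos_leE//; lra.
  have c2 : S * cos t <= S by rewrite ger_pMr// cos_le1.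
  have c3 : T * cos y0 < T.
    by rewrite gtr_pMr// -(cos0 R) cos_ltE ?lexx ?pi_ge0.
  rewrite /w mulrC ltr_pdivlMr// ltr_pdivrMr//; apply/andP; split; first lra.
  by rewrite /M; lra.
have w_le t : x <= t <= x0 -> -1 <= w t <= 1.
  by move=> /w_lt/andP[? ?]; rewrite !ltW.
have hK t : x <= t <= x0 -> cos (h t) = w t.
  by move=> /w_le ht; rewrite /h acosK// in_itv.
have h_itv t : x <= t <= x0 -> 0 <= h t <= pi.
  by move=> /w_le ht; rewrite /h acos_ge0// acos_lepi.
have hlevel t : x <= t <= x0 -> S * cos t + T * cos (h t) = M.
  by move=> /hK ->; rewrite /w mulrA divff// mul1r addrC subrK.
have sh t : x <= t <= x0 -> 0 < sin (h t).
  by move=> /w_lt/andP[? ?]; rewrite sin_gt0_pi// /h acos_gt0 ?acos_ltpi//; lra.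
have hx : x <= x <= x0 by lra.
have hx0' : x <= x0 <= x0 by lra.
have hh0 : h x0 = y0.
  by rewrite /h /w /M addrAC subrr add0r mulKf// cosK// in_itv.
have yh : y <= h x.
  rewrite -cos_leE ?h_itv// -(ler_pM2l T0).
  by have := hlevel _ hx; lra.
pose dh (t : R) := - (S * sin t / (T * sin (h t))).
have h_der t : x <= t <= x0 -> is_derive t (1 : R) h (dh t).
  move=> ht.
  have dw : is_derive t (1 : R) w (T^-1 * (S * sin t)).
    rewrite /w; apply: is_derive_eq.
    by rewrite /= add0r mul1r !scalerN opprK.
  have da := is_derive1_acos (w_lt _ ht).
  have := @is_derive1_comp _ _ w _ _ _ da dw.
  move=> hd; apply: (is_derive_eq hd).
  have -> : Num.sqrt (1 - w t ^+ 2) = sin (h t) by rewrite /h sin_acos// w_le.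
  by rewrite /dh; field; rewrite Tn0 gt_eqF// sh.
have h_cont : {within `[x, x0], continuous h}.
  apply: derivable_within_continuous => t; rewrite in_itv/= => ht.
  exact: (@ex_derive _ _ _ _ _ _ _ (h_der _ ht)).
have [c] : exists2 c, c \in `]x, x0[%R & h x0 - h x = dh c * (x0 - x).
  apply: MVT => // t; rewrite in_itv/= => /andP[? ?].
  by apply: h_der; lra.
rewrite in_itv/= => /andP[xc cx0].
have hc : x <= c <= x0 by lra.
rewrite hh0 /dh => e.
have crs : sin y0 * sin c < sin x0 * sin (h c).
  apply: (@sin_cross_lt _ S T) => //; [lra|exact: h_itv|exact: hlevel].
have hle : T * sin y0 * (y - y0) <= T * sin y0 * (h x - y0).
  by rewrite ler_wpM2l ?lerD2r// mulr_ge0// ltW.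
apply: (le_lt_trans hle).
have -> : h x - y0 = S * sin c / (T * sin (h c)) * (x0 - x) by lra.
rewrite mulrA ltr_pM2r ?subr_gt0// mulrA.
rewrite ltr_pdivrMr; last by rewrite mulr_gt0 ?sh.
have ST0 : 0 < S * T by rewrite mulr_gt0.
have : S * T * (sin y0 * sin c) < S * T * (sin x0 * sin (h c)).
  by rewrite ltr_pM2l.
by lra.
Qed.

Lemma tangent_nonneg {R : realType} (S T x0 y0 x y : R) :
  0 < S -> 0 < T -> `|S - T| < S * cos x0 + T * cos y0 ->
  0 <= x0 <= pi -> 0 <= y0 <= pi -> 0 <= x <= pi -> 0 <= y <= pi ->
  S * cos x0 + T * cos y0 <= S * cos x + T * cos y ->
  (x != x0) || (y != y0) ->
  S * sin x0 * (x - x0) + T * sin y0 * (y - y0) < 0.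
Proof.
move=> S0 T0 hM hx0 hy0 hx hy hL hne.
set M := S * cos x0 + T * cos y0 in hM hL.
have /andP[m1 m2] : (0 < M + S - T) && (0 < M + T - S).
  by move: hM; rewrite ltr_norml => /andP[? ?]; apply/andP; split; lra.
have sx0 : 0 < x0 -> 0 < sin x0.
  move=> x0_gt0; apply: sin_gt0_pi; rewrite x0_gt0 lt_neqAle.
  rewrite (andP hx0).2 andbT; apply/eqP => e; move: m1; rewrite /M e cospi.
  have : 0 <= T * (1 - cos y0) by rewrite mulr_ge0 ?subr_ge0 ?cos_le1// ltW.
  by lra.
have sy0 : 0 < y0 -> 0 < sin y0.
  move=> y0_gt0; apply: sin_gt0_pi; rewrite y0_gt0 lt_neqAle.
  rewrite (andP hy0).2 andbT; apply/eqP => e; move: m2; rewrite /M e cospi.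
  have : 0 <= S * (1 - cos x0) by rewrite mulr_ge0 ?subr_ge0 ?cos_le1// ltW.
  by lra.
have [xx0|xx0|xx0] := ltgtP x x0; have [yy0|yy0|yy0] := ltgtP y y0.
- have h1 : 0 < S * sin x0 * (x0 - x) by rewrite !mulr_gt0 ?sx0//; lra.
  have h2 : 0 < T * sin y0 * (y0 - y) by rewrite !mulr_gt0 ?sy0//; lra.
  by lra.
- have : T * sin y0 * (y - y0) < S * sin x0 * (x0 - x).
    by apply: tangent_corner => //; lra.
  by lra.
- have h1 : 0 < S * sin x0 * (x0 - x) by rewrite !mulr_gt0 ?sx0//; lra.
  by rewrite yy0; lra.
- have : S * sin x0 * (x - x0) < T * sin y0 * (y0 - y).
    apply: tangent_corner => //; rewrite 1?distrC 1?[T * _ + _]addrC//; try lra.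
    by rewrite [T * _ + _]addrC.
  by lra.
- have h1 : S * cos x < S * cos x0 by rewrite ltr_pM2l// cos_ltE.
  have h2 : T * cos y < T * cos y0 by rewrite ltr_pM2l// cos_ltE.
  by move: hL; rewrite /M; lra.
- have h1 : S * cos x < S * cos x0 by rewrite ltr_pM2l// cos_ltE.
  by move: hL; rewrite /M yy0; lra.
- have h2 : 0 < T * sin y0 * (y0 - y) by rewrite !mulr_gt0 ?sy0//; lra.
  by rewrite xx0; lra.
- have h2 : T * cos y < T * cos y0 by rewrite ltr_pM2l// cos_ltE.
  by move: hL; rewrite /M xx0; lra.
- by move: hne; rewrite xx0 yy0 !eqxx.
Qed.

(** Strict convexity of the superlevel set: by the symmetries
    [x => - x] and [y => - y], only points of the first quadrant matter. *)
Lemma tangent_lt {R : realType} (S T x0 y0 x y : R) :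
  0 < S -> 0 < T -> `|S - T| < S * cos x0 + T * cos y0 ->
  `|x0| <= pi -> `|y0| <= pi -> `|x| <= pi -> `|y| <= pi ->
  S * cos x0 + T * cos y0 <= S * cos x + T * cos y ->
  (x != x0) || (y != y0) ->
  S * sin x0 * (x - x0) + T * sin y0 * (y - y0) < 0.
Proof.
move=> S0 T0.
wlog x0_ge0 : x0 x / 0 <= x0.
  move=> wh hM hx0 hy0 hx hy hL hne; have [?|?] := leP 0 x0; first exact: wh.
  have := wh (- x0) (- x); rewrite !cosN sinN !normrN eqr_opp oppr_ge0.
  by move=> /(_ _ hM hx0 hy0 hx hy hL hne); lra.
wlog y0_ge0 : y0 y / 0 <= y0.
  move=> wh hM hx0 hy0 hx hy hL hne; have [?|?] := leP 0 y0; first exact: wh.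
  have := wh (- y0) (- y); rewrite !cosN sinN !normrN eqr_opp oppr_ge0.
  by move=> /(_ _ hM hx0 hy0 hx hy hL hne); lra.
move=> hM; rewrite (ger0_norm x0_ge0) (ger0_norm y0_ge0).
move=> x0pi y0pi hx hy hL hne.
have hx0 : 0 <= x0 <= pi by lra.
have hy0 : 0 <= y0 <= pi by lra.
have px : 0 <= S * sin x0 * (`|x| - x).
  by rewrite !mulr_ge0 ?subr_ge0 ?ler_norm ?sin_ge0_pi// ltW.
have py : 0 <= T * sin y0 * (`|y| - y).
  by rewrite !mulr_ge0 ?subr_ge0 ?ler_norm ?sin_ge0_pi// ltW.
have nn (x' y' : R) : 0 <= x' <= pi -> 0 <= y' <= pi ->
    S * cos x0 + T * cos y0 <= S * cos x' + T * cos y' ->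
    (x' != x0) || (y' != y0) ->
    S * sin x0 * (x' - x0) + T * sin y0 * (y' - y0) < 0.
  by move=> *; apply: tangent_nonneg.
have [|] := boolP ((`|x| != x0) || (`|y| != y0)).
  move=> /(nn `|x| `|y|); rewrite !cos_norm !normr_ge0 hx hy.
  by move=> /(_ isT isT hL); lra.
rewrite negb_or !negbK => /andP[/eqP ex /eqP ey].
(* a point that differs from a nonnegative one by signs only *)
have := nn 0 0; rewrite cos0 !mulr1 lexx pi_ge0.
have c1 : S * cos x0 <= S by rewrite ger_pMr// cos_le1.
have c2 : T * cos y0 <= T by rewrite ger_pMr// cos_le1.
have [x_ge0|x_lt0] := leP 0 x; have [y_ge0|y_lt0] := leP 0 y.
- by move: hne; rewrite -(ger0_norm x_ge0) -(ger0_norm y_ge0) ex ey !eqxx.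
- move: ex ey; rewrite (ger0_norm x_ge0) (ltr0_norm y_lt0) => -> ey _.
  have := nn x0 0; rewrite cos0 lexx pi_ge0 hx0 eqxx subrr mulr0 add0r.
  have -> : (0 != y0) by rewrite -ey eq_sym oppr_eq0 lt_eqF.
  move=> /(_ isT isT); rewrite mulr1 lerD2l => /(_ c2 isT);
  by (have -> : y = - y0 by lra); lra.
- move: ex ey; rewrite (ltr0_norm x_lt0) (ger0_norm y_ge0) => ex -> _.
  have := nn 0 y0; rewrite cos0 lexx pi_ge0 hy0 eqxx subrr mulr0 addr0.
  have -> : (0 != x0) by rewrite -ex eq_sym oppr_eq0 lt_eqF.
  move=> /(_ isT isT); rewrite mulr1 lerD2r => /(_ c1 isT);
  by (have -> : x = - x0 by lra); lra.
- move: ex ey; rewrite (ltr0_norm x_lt0) (ltr0_norm y_lt0) => ex ey.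
  have -> : (0 != x0) by rewrite -ex eq_sym oppr_eq0 lt_eqF.
  move=> /(_ isT isT (lerD c1 c2) isT);
  by (have -> : x = - x0 by lra); (have -> : y = - y0 by lra); lra.
Qed.

(** By central symmetry the four vertices give only two values of
    [S cos x + T cos y]; the weights are chosen to make them equal. *)
Lemma vertices_level {R : realType} (a b a' b' S T : R) :
  S = sin a' * sin b' -> T = sin a * sin b ->
  S * cos (a + b) + T * cos (a' - b') = S * cos (a - b) + T * cos (a' + b').
Proof. by move=> -> ->; rewrite !cosB !cosD; ring. Qed.

(** Since [(a - b, a' + b')] and its opposite lie on the level curve through
    [(a + b, a' - b')], the tangent form at the latter point is positive on
    [(a, a')] and on [(b, - b')]. Hence it is nonnegative at every other point
    [(i, j)] with [1 <= i] and [1 <= j], against [tangent_lt]. *)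
Lemma superlevel_quadrant {R : realType} (a b a' b' S T i j : R) :
  S = sin a' * sin b' -> T = sin a * sin b ->
  0 < a -> 0 < b -> 0 < a' -> 0 < b' -> 0 < S -> 0 < T ->
  a + b <= pi -> a' + b' <= pi ->
  `|S - T| < S * cos (a + b) + T * cos (a' - b') ->
  1 <= i -> 1 <= j ->
  `|i * a + j * b| <= pi -> `|i * a' - j * b'| <= pi ->
  S * cos (a + b) + T * cos (a' - b') <=
    S * cos (i * a + j * b) + T * cos (i * a' - j * b') ->
  i = 1 /\ j = 1.
Proof.
move=> eS eT a0 b0 a'0 b'0 S0 T0 hab ha'b'.
set M := S * cos _ + T * cos _ => hM i1 j1 hx hy hL.
set x0 := a + b; set y0 := a' - b'.
have hx0 : `|x0| <= pi by rewrite ler_norml /x0; lra.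
have hy0 : `|y0| <= pi by rewrite ler_norml /y0; lra.
have hx1 : `|a - b| <= pi by rewrite ler_norml; lra.
have hy1 : `|a' + b'| <= pi by rewrite ler_norml; lra.
have M1 : M = S * cos (a - b) + T * cos (a' + b') by apply: vertices_level.
have tg (x y : R) : `|x| <= pi -> `|y| <= pi -> M <= S * cos x + T * cos y ->
    (x != x0) || (y != y0) ->
    S * sin x0 * (x - x0) + T * sin y0 * (y - y0) < 0.
  by move=> *; apply: tangent_lt.
have B0 : 0 < S * sin x0 * b - T * sin y0 * b'.
  have := tg _ _ hx1 hy1; rewrite -M1 lexx => /(_ isT).
  have -> : a - b != x0 by rewrite lt_eqF// /x0; lra.
  by move=> /(_ isT); rewrite /x0 /y0; lra.
have A0 : 0 < S * sin x0 * a + T * sin y0 * a'.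
  have := tg (- (a - b)) (- (a' + b')); rewrite !normrN !cosN -M1 lexx.
  have -> : - (a - b) != x0 by rewrite lt_eqF// /x0; lra.
  by move=> /(_ hx1 hy1 isT isT); rewrite /x0 /y0; lra.
have hA : 0 <= (i - 1) * (S * sin x0 * a + T * sin y0 * a').
  by rewrite mulr_ge0 ?subr_ge0// ltW.
have hB : 0 <= (j - 1) * (S * sin x0 * b - T * sin y0 * b').
  by apply: mulr_ge0; [rewrite subr_ge0 | exact: ltW].
have [|] := boolP ((i * a + j * b != x0) || (i * a' - j * b' != y0)).
  by move=> /(tg _ _ hx hy hL); rewrite /x0 /y0 in hA hB *; lra.
rewrite negb_or !negbK => /andP[/eqP ex _].
have h1 : 0 <= (i - 1) * a by rewrite mulr_ge0 ?subr_ge0// ltW.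
have h2 : 0 <= (j - 1) * b by rewrite mulr_ge0 ?subr_ge0// ltW.
have e1 : (i - 1) * a = 0 by rewrite /x0 in ex; lra.
have e2 : (j - 1) * b = 0 by rewrite /x0 in ex; lra.
split; apply/eqP; rewrite -subr_eq0.
  by move/eqP: e1; rewrite mulf_eq0 (gt_eqF a0) orbF.
by move/eqP: e2; rewrite mulf_eq0 (gt_eqF b0) orbF.
Qed.

Lemma superlevel_odd_points {R : realType} (a b a' b' S T i j : R) :
  S = sin a' * sin b' -> T = sin a * sin b ->
  0 < a -> 0 < b -> 0 < a' -> 0 < b' -> 0 < S -> 0 < T ->
  a + b <= pi -> a' + b' <= pi ->
  `|S - T| < S * cos (a + b) + T * cos (a' - b') ->
  1 <= `|i| -> 1 <= `|j| ->
  `|i * a + j * b| <= pi -> `|i * a' - j * b'| <= pi ->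
  S * cos (a + b) + T * cos (a' - b') <=
    S * cos (i * a + j * b) + T * cos (i * a' - j * b') ->
  `|i| = 1 /\ `|j| = 1.
Proof.
move=> eS eT a0 b0 a'0 b'0 S0 T0 hab ha'b' hM.
wlog i_ge0 : i j / 0 <= i.
  move=> wh; have [|i0] := leP 0 i; first exact: wh.
  have := wh (- i) (- j); rewrite !mulNr -!opprD !normrN !cosN; apply.
  by rewrite oppr_ge0 ltW.
rewrite (ger0_norm i_ge0) => i1.
have [j_ge0|j_lt0] := leP 0 j => j1 hx hy hL.
  move: j1; rewrite (ger0_norm j_ge0) => j1.
  exact: (superlevel_quadrant a b a' b' S T).
(* exchanging the two planes exchanges the two kinds of quadrants *)
have M1 : S * cos (a + b) + T * cos (a' - b') =
    T * cos (a' + b') + S * cos (a - b).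
  by rewrite [RHS]addrC; apply: vertices_level.
move: j1; rewrite (ltr0_norm j_lt0) => j1.
apply: (superlevel_quadrant a' b' a b T S); rewrite ?mulNr ?opprK//.
- by rewrite distrC -M1.
- by rewrite -M1 [leRHS]addrC.
Qed.

(** * Tangents of multiples of an angle *)

Lemma cos_gt0_acute {R : realType} (x : R) : 0 < x < pi / 2 -> 0 < cos x.
Proof. by move=> hx; apply: cos_gt0_pihalf; have := pi_gt0 R; lra. Qed.

Lemma tan_gt0 {R : realType} (x : R) : 0 < x < pi / 2 -> 0 < tan x.
Proof.
by move=> hx; rewrite divr_gt0 ?cos_gt0_acute// sin_gt0_pihalf.
Qed.

Lemma tan_lt {R : realType} (x y : R) : 0 < x -> x < y -> y < pi / 2 ->
  tan x < tan y.
Proof.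
by move=> x0 xy hy; rewrite ltr_tan// in_itv/=; have := pi_gt0 R; lra.
Qed.

Lemma sin_tan {R : realType} (x : R) : 0 < x < pi / 2 -> sin x = tan x * cos x.
Proof. by move=> hx; rewrite /tan divfK// gt_eqF// cos_gt0_acute. Qed.

Lemma tan_compl {R : realType} (x : R) : 0 < x < pi / 2 ->
  tan (pi / 2 - x) * tan x = 1.
Proof.
move=> hx; rewrite /tan addrC sinDpihalf cosDpihalf cosN sinN opprK.
have := cos_gt0_acute _ hx; have := sin_gt0_pihalf hx => s0 c0.
by field; rewrite !gt_eqF.
Qed.

(** The inductive step of [tanMn_lt_scale]. The strictness comes from the
    denominators in the addition formula, so a large inequality is enough as
    hypothesis. *)
Lemma tanD_lt_scale {R : realType} (X Y x y : R) :
  0 < X -> X < Y -> 0 < x -> x < y -> Y + y < pi / 2 ->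
  tan X * tan y <= tan Y * tan x ->
  tan (X + x) * tan y < tan (Y + y) * tan x.
Proof.
move=> X0 XY x0 xy hY h.
have hX : 0 < X < pi / 2 by lra.
have hY' : 0 < Y < pi / 2 by lra.
have hx : 0 < x < pi / 2 by lra.
have hy : 0 < y < pi / 2 by lra.
have hYy : 0 < Y + y < pi / 2 by lra.
rewrite !tanD ?gt_eqF ?cos_gt0_acute//.
have := cos_gt0_acute _ hYy; rewrite cosD !sin_tan//.
have -> : cos Y * cos y - tan Y * cos Y * (tan y * cos y) =
   (1 - tan Y * tan y) * (cos Y * cos y) by ring.
rewrite pmulr_lgt0 ?mulr_gt0 ?cos_gt0_acute// => d0.
have tX := tan_gt0 _ hX; have tY := tan_gt0 _ hY'.
have tx := tan_gt0 _ hx; have ty := tan_gt0 _ hy.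
have lX : tan X < tan Y by apply: tan_lt; lra.
have lx : tan x < tan y by apply: tan_lt; lra.
have dd : 1 - tan Y * tan y < 1 - tan X * tan x.
  by rewrite ltrD2l ltrN2 ltr_pM// ltW.
have d0' := lt_trans d0 dd.
rewrite [ltLHS]mulrAC [ltRHS]mulrAC ltr_pdivrMr// [ltRHS]mulrAC ltr_pdivlMr//.
have P0 : 0 < (tan Y + tan y) * tan x by rewrite mulr_gt0 ?addr_gt0.
apply: (@le_lt_trans _ _ ((tan Y + tan y) * tan x * (1 - tan Y * tan y))).
  by rewrite ler_pM2r//; lra.
by rewrite ltr_pM2l.
Qed.

(** The ratio [tan (n x) / tan x] increases with [x], for [n >= 2]. *)
Lemma tanMn_lt_scale {R : realType} (c : nat) (x y : R) :
  0 < x -> x < y -> c.+2%:R * y < pi / 2 ->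
  tan (c.+2%:R * x) * tan y < tan (c.+2%:R * y) * tan x.
Proof.
move=> x0 xy; elim: c => [|c IH] hc.
  rewrite !mulr_natl !mulr2n in hc *.
  by apply: tanD_lt_scale => //; rewrite mulrC.
have e (z : R) : c.+3%:R * z = c.+2%:R * z + z.
  by rewrite -natr1 mulrDl mul1r.
have y0 : 0 < y by lra.
have c0 : 0 < c.+2%:R * x by rewrite mulr_gt0.
rewrite !e in hc *; apply: tanD_lt_scale => //.
  by rewrite ltr_pM2l.
by apply/ltW/IH; lra.
Qed.

Lemma acute_mult {R : realType} (th : R) (q n : nat) :
  q%:R * th = pi / 2 -> (0 < n < q)%N -> 0 < n%:R * th < pi / 2.
Proof.
move=> qth /andP[n0 nq]; have q0 : (0 < q)%N by lia.
have th0 : 0 < th.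
  by rewrite -(pmulr_rgt0 _ (_ : 0 < q%:R)) ?ltr0n// qth divr_gt0 ?pi_gt0.
by rewrite mulr_gt0 ?ltr0n//= -qth ltr_pM2r// ltr_nat.
Qed.

Lemma tan_mult_le {R : realType} (th : R) (q m n : nat) :
  q%:R * th = pi / 2 -> (0 < m)%N -> (m <= n)%N -> (n < q)%N ->
  tan (m%:R * th) <= tan (n%:R * th).
Proof.
move=> qth m0 + nq; rewrite leq_eqVlt => /orP[/eqP->//|mn].
have [h1 hm hn] : [/\ 0 < 1 < q, 0 < m < q & 0 < n < q]%N by split; lia.
have /andP[th0 _] := acute_mult th q 1 qth h1; rewrite mul1r in th0.
have /andP[m1 _] := acute_mult th q m qth hm.
have /andP[_ n1] := acute_mult th q n qth hn.
by apply/ltW/tan_lt => //; rewrite ltr_pM2r ?ltr_nat.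
Qed.

(** Writing [t n] for [tan (n th)], one has
    [t a * t b' < t 1 * t (a b') <= t b * t (q - a')] by [tanMn_lt_scale] and
    [a b' <= q - a'], and [t (q - a')] is the inverse of [t a']. *)
Lemma tan3_lt {R : realType} (th : R) (q a b a' b' : nat) :
  q%:R * th = pi / 2 ->
  (a * b' + a' * b = q)%N ->
  (1 < a)%N -> (1 < b')%N -> (0 < a')%N -> (0 < b)%N ->
  tan (a'%:R * th) * tan (b'%:R * th) * tan (a%:R * th) < tan (b%:R * th).
Proof.
move=> qth hq ha hb' ha' hb; pose t (n : nat) := tan (n%:R * th).
change (t a' * t b' * t a < t b).
have acute n := acute_mult th q n qth.
have tle m n := tan_mult_le th q m n qth.
have h1 : (0 < 1 < q)%N by nia.
have th0 : 0 < th by have /andP[] := acute 1%N h1; rewrite mul1r.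
have tp n : (0 < n < q)%N -> 0 < t n by move=> /acute/tan_gt0.
have abq : (a * b' < q)%N by nia.
have s1 : t b' * t a < t (a * b')%N * t 1%N.
  have -> : t (a * b')%N = tan (b'%:R * (a%:R * th)).
    by rewrite /t natrM mulrA (mulrC a%:R).
  rewrite /t mul1r; have habq : (0 < a * b' < q)%N by nia.
  have /andP[_] := acute _ habq; rewrite natrM (mulrC a%:R) -mulrA.
  case: b' hb' {hq abq habq} => [|[|c]]// _ hc.
  by apply: tanMn_lt_scale; rewrite // -[ltLHS]mul1r ltr_pM2r// ltr1n.
have a'q : (0 < a' < q)%N by nia.
have compl : t (q - a')%N * t a' = 1.
  by rewrite /t natrB ?mulrBl ?qth ?tan_compl ?acute//; lia.
have s2 : t (a * b')%N * t 1%N <= t (q - a')%N * t b.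
  by apply: ler_pM; [apply/ltW/tp|apply/ltW/tp|apply: tle|apply: tle]; nia.
have e1 : t b = t (q - a')%N * t b * t a' by rewrite mulrAC compl mul1r.
have e2 : t a' * t b' * t a = t b' * t a * t a' by ring.
by rewrite e2 e1 ltr_pM2r ?tp// (lt_le_trans s1).
Qed.

Lemma entries_lt (q a b a' b' : nat) : (a * b' + a' * b = q)%N ->
  (0 < a)%N -> (0 < b)%N -> (0 < a')%N -> (0 < b')%N ->
  [/\ 0 < a < q, 0 < b < q, 0 < a' < q & 0 < b' < q]%N.
Proof. by move=> *; split; nia. Qed.

Lemma ltr_pM_swap {R : realFieldType} (w x y : R) :
  0 < w -> x <= y -> w * y < x -> w * x < y.
Proof.
move=> w0 xy h; apply: (lt_le_trans _ xy); apply: (le_lt_trans _ h).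
by rewrite ler_pM2l.
Qed.

(** Once [1 < a] and [1 < b'], the products involving [a] and [b'] on the left
    are bounded by [tan3_lt]; for the other two, either [tan3_lt] applies as
    well or [b] or [a'] is [1], which gives the least tangent of all. *)
Lemma tan3_lt_all {R : realType} (th : R) (q a b a' b' : nat)
    (t := fun n : nat => tan (n%:R * th)) :
  q%:R * th = pi / 2 ->
  (a * b' + a' * b = q)%N ->
  (1 < a)%N -> (1 < b')%N -> (0 < a')%N -> (0 < b)%N ->
  [/\ t a' * t b' * t b < t a, t a' * t b' * t a < t b,
      t a * t b * t b' < t a' & t a * t b * t a' < t b'].
Proof.
move=> qth hq ha hb' ha' hb.
have [|||//|aq bq a'q b'q] := entries_lt q a b a' b' hq; try lia.
have [ta tb ta' tb'] : [/\ 0 < t a, 0 < t b, 0 < t a' & 0 < t b'].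
  by split; apply/tan_gt0/(acute_mult th q).
have h2 : t a' * t b' * t a < t b by apply: tan3_lt hq _ _ _ _.
have h3 : t a * t b * t b' < t a'.
  have -> : t a * t b * t b' = t b * t b' * t a by ring.
  by apply: (tan3_lt th q) => //; lia.
have t1 n : (0 < n < q)%N -> t 1%N <= t n.
  by move=> hn; apply: (tan_mult_le th q) => //; lia.
have [b1|b1] := leqP b 1.
  have eb : b = 1%N by lia.
  split=> //; first by apply: ltr_pM_swap h2; [rewrite mulr_gt0|rewrite eb t1].
  have -> : t a * t b * t a' = t a' * t a * t b by ring.
  apply: ltr_pM_swap; [by rewrite mulr_gt0|by rewrite eb t1|].
  by have -> : t a' * t a * t b' = t a' * t b' * t a by ring.
have [a1|a1] := leqP a' 1.
  have ea : a' = 1%N by lia.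
  split=> //; last by apply: ltr_pM_swap h3; [rewrite mulr_gt0|rewrite ea t1].
  have -> : t a' * t b' * t b = t b' * t b * t a' by ring.
  apply: ltr_pM_swap; [by rewrite mulr_gt0|by rewrite ea t1|].
  by have -> : t b' * t b * t a = t a * t b * t b' by ring.
split=> //; last by apply: (tan3_lt th q) => //; lia.
by rewrite [t a' * _]mulrC; apply: (tan3_lt th q) => //; lia.
Qed.

(** * The common value at the four vertices is above the saddles *)

(** The right side minus the left one is a positive multiple of the product of
    [tan al - tan al' tan be' tan be] and
    [tan be - tan al' tan be' tan al]. *)
Lemma saddle_lt {R : realType} (al be al' be' S T : R) :
  0 < al < pi / 2 -> 0 < be < pi / 2 -> 0 < al' < pi / 2 -> 0 < be' < pi / 2 ->
  S = sin (al' *+ 2) * sin (be' *+ 2) -> T = sin (al *+ 2) * sin (be *+ 2) ->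
  tan al' * tan be' * tan be < tan al -> tan al' * tan be' * tan al < tan be ->
  S - T < S * cos (al *+ 2 + be *+ 2) + T * cos (al' *+ 2 - be' *+ 2).
Proof.
move=> ha hb ha' hb' -> -> h1 h2; rewrite -subr_gt0.
rewrite -mulrnDl -mulrnBl !cos_mulr2n !sin_mulr2n cosB.
have -> : cos (al + be) ^+ 2 = 1 - sin (al + be) ^+ 2 by rewrite cos2sin2.
rewrite sinD !sin_tan//.
set t := tan al in h1 h2 *; set u := tan be in h1 h2 *.
set t' := tan al' in h1 h2 *; set u' := tan be' in h1 h2 *.
set P := (X in 0 < X).
have -> : P = 8 * (cos al * cos be * cos al' * cos be') ^+ 2 *
    ((t - t' * u' * u) * (u - t' * u' * t)).
  by rewrite /P; ring.
by rewrite mulr_gt0 ?mulr_gt0 ?exprn_gt0 ?mulr_gt0 ?cos_gt0_acute ?subr_gt0.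
Qed.

(** Both inequalities behind the absolute value are instances of [saddle_lt],
    one read at the vertex [(a + b, a' - b')], the other, with the two planes
    exchanged, at the vertex [(a - b, a' + b')]. *)
Lemma level_gt_saddle {R : realType} (q a b a' b' : nat)
    (r := fun n : nat => n%:R * (pi / q%:R) : R)
    (S := sin (r a') * sin (r b')) (T := sin (r a) * sin (r b)) :
  (a * b' + a' * b = q)%N ->
  (0 < a)%N -> (0 < b)%N -> (0 < a')%N -> (0 < b')%N ->
  ~ (a = 1%N /\ b = 1%N) -> ~ (a' = 1%N /\ b' = 1%N) ->
  ~ (a = 1%N /\ a' = 1%N) -> ~ (b = 1%N /\ b' = 1%N) ->
  `|S - T| < S * cos (r a + r b) + T * cos (r a' - r b').
Proof.
move=> hq a0 b0 a'0 b'0 n1 n2 n3 n4.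
have q0 : (0 < q)%N by nia.
pose th := pi / 2 / q%:R : R; pose t (n : nat) := tan (n%:R * th).
have qth : q%:R * th = pi / 2 by rewrite mulrC divfK// pnatr_eq0 -lt0n.
have rE n : r n = (n%:R * th) *+ 2.
  by rewrite /r /th -mulr_natr; field; rewrite pnatr_eq0 -lt0n.
have [aq bq a'q b'q] := entries_lt q a b a' b' hq a0 b0 a'0 b'0.
have [h1 h2 h3 h4] : [/\ t a' * t b' * t b < t a, t a' * t b' * t a < t b,
    t a * t b * t b' < t a' & t a * t b * t a' < t b'].
  have [] : (1 < a)%N /\ (1 < b')%N \/ (1 < b)%N /\ (1 < a')%N by lia.
    by case=> *; apply: (tan3_lt_all th q).
  case=> *; have [|||||] := tan3_lt_all th q b a b' a' qth; try lia.
  by rewrite -/th -/t /= !(mulrC (t b') (t a')) !(mulrC (t b) (t a)).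
have s1 : S - T < S * cos (r a + r b) + T * cos (r a' - r b').
  by rewrite !rE; apply: saddle_lt h1 h2; rewrite ?(acute_mult th q)// /S /T !rE.
have s2 : T - S < T * cos (r a' + r b') + S * cos (r a - r b).
  by rewrite !rE; apply: saddle_lt h3 h4; rewrite ?(acute_mult th q)// /S /T !rE.
have M1 : S * cos (r a + r b) + T * cos (r a' - r b') =
    T * cos (r a' + r b') + S * cos (r a - r b).
  by rewrite [RHS]addrC; apply: vertices_level.
by rewrite ltr_norml; apply/andP; split; lra.
Qed.

(** * The maximum over the orbit *)

Lemma cosDz2pi {R : realType} (t : R) (z : int) :
  cos (t + z%:~R * (2 * pi)) = cos t.
Proof.
have cosn (s : R) (n : nat) : cos (s + n%:R * (2 * pi)) = cos s.
  by rewrite mulr_natl mulr_natl; exact: (periodicn (@cosD2pi R)).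
case: z => n; first exact: cosn.
by rewrite NegzE -{2}(subrK (n.+1%:R * (2 * pi)) t) cosn rmorphN mulNr.
Qed.

Lemma sin_angle_gt0 {R : realType} (q n : nat) : (0 < n < q)%N ->
  0 < sin (n%:R * (pi / q%:R) : R).
Proof.
move=> /andP[n0 nq]; have qR : 0 < q%:R :> R by rewrite ltr0n; lia.
apply: sin_gt0_pi; rewrite mulr_gt0 ?ltr0n ?divr_gt0 ?pi_gt0//=.
by rewrite mulrCA gtr_pMr ?pi_gt0// ltr_pdivrMr// mul1r ltr_nat.
Qed.

Lemma angleD_lt_pi {R : realType} (q m n : nat) : (m + n < q)%N ->
  m%:R * (pi / q%:R) + n%:R * (pi / q%:R) < pi :> R.
Proof.
move=> mn; have qR : 0 < q%:R :> R by rewrite ltr0n; lia.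
rewrite -mulrDl -natrD mulrCA gtr_pMr ?pi_gt0//.
by rewrite ltr_pdivrMr// mul1r ltr_nat.
Qed.

Lemma centered_residue (q c z : int) : 0 < q ->
  exists w : int, `|2 * (z + w * q) - c| <= q.
Proof.
move=> q0; exists (- ((2 * z - c + q) %/ (2 * q))%Z).
have := divz_eq (2 * z - c + q) (2 * q).
have : 0 <= ((2 * z - c + q) %% (2 * q))%Z by apply: modz_ge0; lia.
have : ((2 * z - c + q) %% (2 * q))%Z < 2 * q by apply: ltz_pmod; lia.
set d := (_ %/ _)%Z; set r := (_ %% _)%Z; rewrite ler_norml => *.
by apply/andP; split; lia.
Qed.

(** The lattice point of [k] is first moved into the square of side [q] around
    the center by multiples of [q]; this gives [(K, L)], whose coordinates
    [(m, n)] in the basis [(a, a')], [(b, - b')] are found by Cramer's rule and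
    are integers by the congruences on [p a] and [p b]. Then
    [superlevel_odd_points] applies to [i = 2 m - 1] and [j = 2 n - 1]. *)
Lemma max_on_orbit {R : realType} (p q a b a' b' : nat) (e al be : int)
    (r := fun n : nat => n%:R * (pi / q%:R) : R)
    (S := sin (r a') * sin (r b')) (T := sin (r a) * sin (r b))
    (f := fun k : nat => S * cos (k%:R * (2 * pi / q%:R) - (r a + r b)) +
      T * cos (k%:R * (p%:R * (2 * pi / q%:R)) - e%:~R * (r a' - r b')))
    (M := S * cos (r a + r b) + T * cos (r a' - r b')) (k : nat) :
  (a * b' + a' * b = q)%N -> e * e = 1 ->
  (p * a)%N%:Z = al * q%:Z + e * a'%:Z ->
  (p * b)%N%:Z = be * q%:Z - e * b'%:Z ->
  (0 < a)%N -> (0 < b)%N -> (0 < a')%N -> (0 < b')%N ->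
  ~ (a = 1%N /\ b = 1%N) -> ~ (a' = 1%N /\ b' = 1%N) ->
  ~ (a = 1%N /\ a' = 1%N) -> ~ (b = 1%N /\ b' = 1%N) ->
  M <= f k -> exists2 c, c \in [:: 0; a; b; a + b]%N & k = c %[mod q].
Proof.
move=> hq he ea eb a0 b0 a'0 b'0 n1 n2 n3 n4 hf.
have q0 : (0 < q)%N by nia.
have [aq bq a'q b'q] := entries_lt q a b a' b' hq a0 b0 a'0 b'0.
have [abq a'b'q] : (a + b < q)%N /\ (a' + b' < q)%N.
  by split; clear -hq a0 b0 a'0 b'0 n1 n2; nia.
have e_sign : e = 1 \/ e = -1 by clear -he; nia.
have qR : 0 < q%:R :> R by rewrite ltr0n.
have pi0 := pi_gt0 R.
have [w hK] := centered_residue q%:Z (a%:Z + b%:Z) k%:Z q0.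
have [w' hL] := centered_residue q%:Z (a'%:Z - b'%:Z) (e * p%:Z * k%:Z) q0.
set K := k%:Z + w * q%:Z in hK.
set L := e * p%:Z * k%:Z + w' * q%:Z in hL.
pose m := k%:Z * e * be + w * b'%:Z + w' * b%:Z.
pose n := - (k%:Z * e * al) + w * a'%:Z - w' * a%:Z.
have mq : m * q%:Z = K * b'%:Z + L * b%:Z.
  have -> : m * q%:Z =
      k%:Z * e * (be * q%:Z) + w * b'%:Z * q%:Z + w' * b%:Z * q%:Z.
    by rewrite /m; ring.
  have -> : be * q%:Z = p%:Z * b%:Z + e * b'%:Z by lia.
  have -> : k%:Z * e * (p%:Z * b%:Z + e * b'%:Z) =
     k%:Z * (e * e) * b'%:Z + k%:Z * e * (p%:Z * b%:Z) by ring.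
  by rewrite he /K /L; ring.
have nq : n * q%:Z = K * a'%:Z - L * a%:Z.
  have -> : n * q%:Z =
      - (k%:Z * e * (al * q%:Z)) + w * a'%:Z * q%:Z - w' * a%:Z * q%:Z.
    by rewrite /n; ring.
  have -> : al * q%:Z = p%:Z * a%:Z - e * a'%:Z by lia.
  have -> : k%:Z * e * (p%:Z * a%:Z - e * a'%:Z) =
     k%:Z * e * (p%:Z * a%:Z) - k%:Z * (e * e) * a'%:Z by ring.
  by rewrite he /K /L; ring.
have hqz : q%:Z = a%:Z * b'%:Z + a'%:Z * b%:Z by lia.
have qz0 : q%:Z != 0 by lia.
have eK : K = m * a%:Z + n * b%:Z.
  apply: (mulIf qz0).
  have -> : (m * a%:Z + n * b%:Z) * q%:Z =
      m * q%:Z * a%:Z + n * q%:Z * b%:Z by ring.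
  by rewrite mq nq hqz; ring.
have eL : L = m * a'%:Z - n * b'%:Z.
  apply: (mulIf qz0).
  have -> : (m * a'%:Z - n * b'%:Z) * q%:Z =
      m * q%:Z * a'%:Z - n * q%:Z * b'%:Z by ring.
  by rewrite mq nq hqz; ring.
pose i : R := (2 * m - 1)%:~R; pose j : R := (2 * n - 1)%:~R.
have ex : i * r a + j * r b = (2 * K - (a%:Z + b%:Z))%:~R * (pi / q%:R).
  by rewrite eK /i /j /r !(rmorphD, rmorphB, rmorphM, rmorphN)/= -!pmulrn; ring.
have ey : i * r a' - j * r b' = (2 * L - (a'%:Z - b'%:Z))%:~R * (pi / q%:R).
  by rewrite eL /i /j /r !(rmorphD, rmorphB, rmorphM, rmorphN)/= -!pmulrn; ring.
have small (z : int) : `|z| <= q%:Z -> `|z%:~R * (pi / q%:R)| <= pi :> R.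
  move=> hz; rewrite normrM (ger0_norm (_ : 0 <= pi / q%:R)); last first.
    by rewrite divr_ge0 ?ltW.
  rewrite mulrCA ger_pMr// ler_pdivrMr// mul1r -intr_norm.
  by rewrite (_ : q%:R = q%:Z%:~R)// ler_int.
have odd_ge1 (z : int) : 1 <= `|(2 * z - 1)%:~R| :> R.
  by rewrite -intr_norm -[leLHS]/(1%:~R) ler_int; lia.
have rp c : (0 < c)%N -> 0 < r c.
  by move=> c0; rewrite mulr_gt0 ?ltr0n ?divr_gt0.
have fE : f k = S * cos (i * r a + j * r b) + T * cos (i * r a' - j * r b').
  have -> : i * r a + j * r b =
      k%:R * (2 * pi / q%:R) - (r a + r b) + w%:~R * (2 * pi).
    rewrite ex /K /r !(rmorphD, rmorphB, rmorphM, rmorphN)/= -!pmulrn.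
    by field; rewrite gt_eqF.
  have eR : e%:~R * e%:~R = 1 :> R by rewrite -intrM he.
  have cose (z : R) : cos (e%:~R * z) = cos z.
    have [->|->] := e_sign.
      by rewrite mul1r.
    by rewrite mulN1r cosN.
  rewrite cosDz2pi -(cose (i * r a' - j * r b')).
  have -> : e%:~R * (i * r a' - j * r b') =
      (e%:~R * e%:~R) * k%:R * (p%:R * (2 * pi / q%:R))
      - e%:~R * (r a' - r b') + (e * w')%:~R * (2 * pi).
    rewrite ey /L /r !(rmorphD, rmorphB, rmorphM, rmorphN)/= -!pmulrn.
    by field; rewrite gt_eqF.
  by rewrite cosDz2pi eR mul1r.
have [] : `|i| = 1 /\ `|j| = 1.
  apply: (superlevel_odd_points (r a) (r b) (r a') (r b') S T) => //; rewrite ?rp//.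
  - by rewrite mulr_gt0 ?sin_angle_gt0.
  - by rewrite mulr_gt0 ?sin_angle_gt0.
  - exact/ltW/angleD_lt_pi.
  - exact/ltW/angleD_lt_pi.
  - exact: level_gt_saddle.
  - exact: odd_ge1.
  - exact: odd_ge1.
  - by rewrite ex small.
  - by rewrite ey small.
  - by rewrite -fE.
have vertex (z : int) : `|(2 * z - 1)%:~R| = 1 :> R -> z = 0 \/ z = 1.
  by rewrite -intr_norm => /eqP; rewrite -[1]/(1%:~R) eqr_int => /eqP; lia.
have cK (c : nat) : K = c%:Z -> k = c %[mod q].
  rewrite /K => h; apply/eqP; rewrite -eqz_nat -!modz_nat -h.
  by rewrite addrC modzMDl.
move=> /vertex hm /vertex hn; move: eK.
case: hm => ->; case: hn => -> eK; rewrite ?mul0r ?mul1r ?add0r ?addr0 in eK.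
- by exists 0%N; rewrite ?inE//; apply: cK.
- by exists b; rewrite ?inE ?eqxx ?orbT//; apply: cK.
- by exists a; rewrite ?inE ?eqxx ?orbT//; apply: cK.
- by exists (a + b)%N; rewrite ?inE ?eqxx ?orbT//; apply: cK.
Qed.

(** * Faces of convex hulls *)

Lemma pairing_conv {R : realType} {n : nat} (u : 'cV[R]_n) (x y : 'rV[R]_n)
    (l : R) :
  ((l *: x + (1 - l) *: y) *m u) 0 0 = l * (x *m u) 0 0 + (1 - l) * (y *m u) 0 0.
Proof. by rewrite mulmxDl -!scalemxAl !mxE. Qed.

Lemma conv_hull_hyperplane {R : realType} {n : nat} {A : set 'rV[R]_n}
    {u : 'cV[R]_n} {c : R} :
  (forall x, A x -> (x *m u) 0 0 = c) ->
  forall x, conv_hull A x -> (x *m u) 0 0 = c.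
Proof.
move=> Aeq; suff : conv_hull A `<=` [set x | (x *m u) 0 0 = c] by [].
apply: smallest_sub => // y z l /set_mem /= ey /set_mem /= ez.
by apply/mem_set; rewrite /= /conv/= pairing_conv ey ez; lra.
Qed.

(** The points that are below the hyperplane, or on it and in the hull of [A],
    form a convex set, which therefore contains the hull of [V]. *)
Lemma conv_hull_face {R : realType} {n : nat} (V A : set 'rV[R]_n)
    (u : 'cV[R]_n) (c : R) :
  u != 0 -> A `<=` V ->
  (forall x, V x -> (x *m u) 0 0 <= c) ->
  (forall x, V x -> (x *m u) 0 0 = c -> A x) ->
  (forall x, A x -> (x *m u) 0 0 = c) ->
  is_face (conv_hull V) (conv_hull A).
Proof.
move=> u0 AV Vle VA Aeq.
pose W : set 'rV[R]_n := [set x | (x *m u) 0 0 <= c /\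
  ((x *m u) 0 0 = c -> conv_hull A x)].
have hullW : conv_hull V `<=` W.
  apply: smallest_sub; last first.
    move=> x Vx; split; first exact: Vle.
    by move=> /(VA _ Vx) Ax; apply: sub_gen_smallest.
  apply/convex_setW => x y /set_mem [xc xA] /set_mem [yc yA] l l0 l1.
  apply/mem_set; rewrite /W /= /conv/= pairing_conv.
  have l1' : 0 < 1 - l%:num by rewrite subr_gt0.
  have hx : l%:num * (x *m u) 0 0 <= l%:num * c by rewrite ler_pM2l.
  have hy : (1 - l%:num) * (y *m u) 0 0 <= (1 - l%:num) * c by rewrite ler_pM2l.
  split; first by lra.
  move=> h.
  have ex : (x *m u) 0 0 = c by apply: (mulfI (lt0r_neq0 l0)); lra.
  have ey : (y *m u) 0 0 = c by apply: (mulfI (lt0r_neq0 l1')); lra.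
  move=> B [Bc AB]; apply/set_mem; apply: (Bc); apply/mem_set.
    exact: xA ex B (conj Bc AB).
  exact: yA ey B (conj Bc AB).
exists u, c; split=> //; first by move=> x /hullW[].
apply/seteqP; split=> x; last by move=> [/hullW[_ h] /h].
move=> Ax; split; last exact: (conv_hull_hyperplane Aeq).
by move=> B [Bc VB]; apply: (Ax); split=> // y /AV /VB.
Qed.

Lemma hyperplane_dim {R : realType} {d : nat} (F : set 'rV[R]_d.+1)
    (u : 'cV[R]_d.+1) (c : R) :
  u != 0 -> (forall x, F x -> (x *m u) 0 0 = c) ->
  ~ (exists v : 'I_d.+2 -> 'rV[R]_d.+1,
       (forall i, F (v i)) /\ affinely_independent v).
Proof.
move=> u0 Fu [v [Fv]]; rewrite /affinely_independent row_free_unit => mv.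
move: u0; apply/negP; rewrite negbK -(mulKmx mv u).
rewrite (_ : _ *m u = 0) ?mulmx0//.
have sub0 (X Y : 'M[R]_1) : X 0 0 = c -> Y 0 0 = c -> X - Y = 0.
  by move=> eX eY; apply/matrixP => i j; rewrite !ord1 !mxE eX eY subrr.
apply/row_matrixP => i; rewrite row_mul rowK row0 mulmxBl.
by apply: sub0; apply: Fu.
Qed.

(** A linear relation between the edge vectors is tested through linear forms,
    for which the phases below can be used. *)
Lemma affinely_independentP {R : realType} {n d : nat}
    (v : 'I_d.+1 -> 'rV[R]_n) :
  (forall l : 'I_d -> R, (forall u : 'cV[R]_n,
      \sum_(i < d) l i * ((v (lift ord0 i) *m u) 0 0 - (v ord0 *m u) 0 0) = 0) ->
    forall i, l i = 0) ->
  affinely_independent v.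
Proof.
move=> H; apply: inj_row_free => l hl.
apply/rowP => i; rewrite mxE; apply: (H (l 0)) => u.
transitivity ((l *m (\matrix_(i < d) (v (lift ord0 i) - v ord0)) *m u) 0 0).
  rewrite -mulmxA [RHS]mxE; apply: eq_bigr => k _; congr (_ * _).
  by rewrite !mxE -sumrB; apply: eq_bigr => m _; rewrite !mxE; ring.
by rewrite hl mul0mx mxE.
Qed.

(** * The orbit in coordinates *)

Lemma expiD {R : realType} (x y : R) : expi (x + y) = expi x * expi y.
Proof.
rewrite /expi cosD sinD.
apply/eqP; rewrite eq_complex /= eqxx /=.
by apply/eqP; ring.
Qed.


Lemma x_expi {R : realType} (p q k : nat) :
  x_ p q k = real4 (expi (k%:R * (2 * pi / q%:R)) : R[i],
    expi (k%:R * (p%:R * (2 * pi / q%:R)))).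
Proof.
rewrite /x_; congr real4; elim: k => [|k IH].
  by rewrite /= !mul0r /expi cos0 sin0.
rewrite iterS IH /phi /= -!expiD.
by congr (expi _, expi _); rewrite -natr1; ring.
Qed.

(** The linear form on pairs of points of the unit circle whose value is a sum
    of two cosines, with amplitudes [A], [B] and phases [s], [t]; every linear
    form on the ambient space is of this kind. *)
Definition wave_col {R : realType} (A s B t : R) : 'cV[R]_4 :=
  \col_(i < 4) [:: A * cos s; A * sin s; B * cos t; B * sin t]`_i.

Lemma x_wave {R : realType} (p q k : nat) (A s B t : R) :
  (x_ p q k *m wave_col A s B t) 0 0 =
  A * cos (k%:R * (2 * pi / q%:R) - s) +
  B * cos (k%:R * (p%:R * (2 * pi / q%:R)) - t).
Proof.
rewrite x_expi mxE !big_ord_recl big_ord0 !mxE /= !cosB.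
by ring.
Qed.

Lemma x_modn {R : realType} (p q k c : nat) : (0 < q)%N ->
  k = c %[mod q] -> x_ p q k = x_ p q c :> 'rV[R]_4.
Proof.
move=> q0 h; suff xmod m : x_ p q m = x_ p q (m %% q) :> 'rV[R]_4.
  by rewrite xmod h -xmod.
have cosz (s : R) (z : int) : expi (s + z%:~R * (2 * pi)) = expi s.
  rewrite /expi -[in LHS]cosBpihalf.
  by rewrite addrAC !cosDz2pi cosBpihalf.
rewrite !x_expi; congr (real4 (_, _)).
  rewrite -[RHS](cosz _ (m %/ q)%N); congr expi.
  rewrite {1}(divn_eq m q) natrD natrM -pmulrn; field.
  by rewrite pnatr_eq0 -lt0n.
rewrite -[RHS](cosz _ (p * (m %/ q))%N); congr expi.
rewrite {1}(divn_eq m q) natrD natrM -pmulrn natrM; field.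
by rewrite pnatr_eq0 -lt0n.
Qed.

(** * The tetrahedron *)

Lemma sin_mul_le_norm {R : realType} (x y : R) : `|x| <= pi -> `|y| <= pi ->
  sin x * sin y <= sin `|x| * sin `|y|.
Proof.
move=> hx hy.
have sx : 0 <= sin `|x| by rewrite sin_ge0_pi// normr_ge0.
have sy : 0 <= sin `|y| by rewrite sin_ge0_pi// normr_ge0.
have : 0 <= sin `|x| * sin `|y| by rewrite mulr_ge0.
case: (ger0P x) => _; case: (ger0P y) => _; rewrite ?sinN; lra.
Qed.

(** With weights summing to zero on the vertices [(1, -1)], [(-1, 1)], [(1, 1)]
    and [(-1, -1)], the three equations say that one cosine and two sines have
    weighted sum zero. The determinant of the equations in the sines is nonzero
    by [sin_cross_lt] for the two adjacent vertices. *)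
Lemma independent_phases {R : realType} (a b a' b' S T l1 l2 l3 : R) :
  S = sin a' * sin b' -> T = sin a * sin b ->
  0 < a -> 0 < b -> 0 < a' -> 0 < b' -> 0 < S -> 0 < T ->
  a + b < pi -> a' + b' < pi ->
  `|S - T| < S * cos (a + b) + T * cos (a' - b') ->
  (l1 + l2) * (cos (a - b) - cos (a + b)) = 0 ->
  (l1 - l2) * sin (a - b) + (l1 + l2 + l3 *+ 2) * sin (a + b) = 0 ->
  (l1 - l2) * sin (a' + b') + (l1 + l2 + l3 *+ 2) * sin (a' - b') = 0 ->
  [/\ l1 = 0, l2 = 0 & l3 = 0].
Proof.
move=> eS eT a0 b0 a'0 b'0 S0 T0 hab ha'b' hM.
have M1 := vertices_level _ _ _ _ _ _ eS eT.
have hD : `|a - b| < a + b by rewrite ltr_norml; lra.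
have hD' : `|a' - b'| < a' + b' by rewrite ltr_norml; lra.
have nD := normr_ge0 (a - b); have nD' := normr_ge0 (a' - b').
have cos_lt : cos (a + b) < cos (a - b).
  by rewrite -(cos_norm (a - b)) cos_ltE//; lra.
have det : sin (a - b) * sin (a' - b') < sin (a + b) * sin (a' + b').
  have le1 := sin_mul_le_norm (a - b) (a' - b').
  apply: (@le_lt_trans _ _ (sin `|a - b| * sin `|a' - b'|)).
    by apply: le1; lra.
  by rewrite mulrC; apply: (sin_cross_lt S T); rewrite ?cos_norm//; lra.
have sin_pos : 0 < sin (a + b) by apply: sin_gt0_pi; lra.
move=> /eqP; rewrite mulf_eq0 [X in _ || X]subr_eq0 (gt_eqF cos_lt) orbF.
move=> /eqP l12.
rewrite l12 add0r => h1 h2.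
set d := l1 - l2 in h1 h2.
have : d * (sin (a + b) * sin (a' + b') - sin (a - b) * sin (a' - b')) = 0.
  rewrite (_ : _ * _ =
    sin (a + b) * (d * sin (a' + b') + l3 *+ 2 * sin (a' - b')) -
    sin (a' - b') * (d * sin (a - b) + l3 *+ 2 * sin (a + b))); last by ring.
  by rewrite h1 h2; ring.
move=> /eqP; rewrite mulf_eq0 [X in _ || X]subr_eq0 (gt_eqF det) orbF.
move=> /eqP d0.
move: h1; rewrite d0 mul0r add0r => /eqP.
rewrite mulf_eq0 (gt_eqF sin_pos) orbF => /eqP l30.
by rewrite /d in d0; split; lra.
Qed.

(** The theorem in terms of the basis [(a, e a')], [(b, - e b')] of the lattice
    of the orbit; the exchange of the two fractions only changes the sign [e]. *)
Lemma tetrahedron_face {R : realType} (p q a b a' b' : nat) (e al be : int)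
    (x := @x_ R p q) :
  (a * b' + a' * b = q)%N -> e * e = 1 ->
  (p * a)%N%:Z = al * q%:Z + e * a'%:Z ->
  (p * b)%N%:Z = be * q%:Z - e * b'%:Z ->
  (0 < a)%N -> (0 < b)%N -> (0 < a')%N -> (0 < b')%N ->
  ~ (a = 1%N /\ b = 1%N) -> ~ (a' = 1%N /\ b' = 1%N) ->
  ~ (a = 1%N /\ a' = 1%N) -> ~ (b = 1%N /\ b' = 1%N) ->
  let T := conv_hull [set x 0%N; x a; x b; x (a + b)%N] in
  [/\ is_face (Pi_ p q) T,
      has_dim 3 T &
      affinely_independent (tnth [tuple x 0%N; x a; x b; x (a + b)%N])].
Proof.
move=> hq he ea eb a0 b0 a'0 b'0 n1 n2 n3 n4.
pose r (n : nat) : R := n%:R * (pi / q%:R).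
pose S := sin (r a') * sin (r b'); pose T := sin (r a) * sin (r b).
pose M := S * cos (r a + r b) + T * cos (r a' - r b').
pose s := r a + r b; pose t := e%:~R * (r a' - r b').
pose w (A s' B t' : R) (k : nat) := A * cos (k%:R * (2 * pi / q%:R) - s') +
  B * cos (k%:R * (p%:R * (2 * pi / q%:R)) - t').
have hM : `|S - T| < M by apply: level_gt_saddle.
have hmax k : M <= w S s T t k ->
    exists2 c, c \in [:: 0; a; b; a + b]%N & k = c %[mod q].
  by apply: (max_on_orbit p q a b a' b' e al be).
have q0 : (0 < q)%N by nia.
have qR : 0 < q%:R :> R by rewrite ltr0n.
have [aq bq a'q b'q] := entries_lt q a b a' b' hq a0 b0 a'0 b'0.
have [abq a'b'q] : (a + b < q)%N /\ (a' + b' < q)%N.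
  by split; clear -hq a0 b0 a'0 b'0 n1 n2; nia.
have e_sign : e = 1 \/ e = -1 by clear -he; nia.
have cose (z : R) : cos (e%:~R * z) = cos z.
  by case: e_sign => ->; rewrite ?mul1r// mulN1r cosN.
have sine (z : R) : sin (e%:~R * z) = e%:~R * sin z.
  by case: e_sign => ->; rewrite ?mul1r// !mulN1r sinN.
have rp c : (0 < c)%N -> 0 < r c.
  by move=> c0; rewrite mulr_gt0 ?ltr0n// divr_gt0// pi_gt0.
have ra := rp _ a0; have rb := rp _ b0.
have ra' := rp _ a'0; have rb' := rp _ b'0.
have rab : r a + r b < pi := angleD_lt_pi _ _ _ abq.
have ra'b' : r a' + r b' < pi := angleD_lt_pi _ _ _ a'b'q.
have S0 : 0 < S by rewrite mulr_gt0 ?sin_angle_gt0.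
have T0 : 0 < T by rewrite mulr_gt0 ?sin_angle_gt0.
have M1 : M = S * cos (r a - r b) + T * cos (r a' + r b').
  exact: vertices_level.
(* the phases of the four vertices, up to a common shift of each plane *)
have ea_R : p%:R * a%:R = al%:~R * q%:R + e%:~R * a'%:R :> R.
  by rewrite -natrM pmulrn ea rmorphD !rmorphM.
have eb_R : p%:R * b%:R = be%:~R * q%:R - e%:~R * b'%:R :> R.
  by rewrite -natrM pmulrn eb rmorphB !rmorphM.
have w_0 A s' B t' : w A (s + s') B (t + t') 0%N =
    A * cos (- (r a + r b) - s') + B * cos (e%:~R * - (r a' - r b') - t').
  by rewrite /w !mul0r /s /t; congr (_ * cos _ + _ * cos _); ring.
have w_a A s' B t' : w A (s + s') B (t + t') a =
    A * cos (r a - r b - s') + B * cos (e%:~R * (r a' + r b') - t').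
  rewrite /w -(cosDz2pi (e%:~R * _ - t') al) /s /t /r.
  congr (_ * cos _ + _ * cos _); first by field; rewrite gt_eqF.
  rewrite [LHS](_ : _ = (p%:R * a%:R) * (2 * pi / q%:R) -
    (e%:~R * (r a' - r b') + t')); last by rewrite /r; ring.
  by rewrite ea_R /r; field; rewrite gt_eqF.
have w_b A s' B t' : w A (s + s') B (t + t') b =
    A * cos (- (r a - r b) - s') + B * cos (e%:~R * - (r a' + r b') - t').
  rewrite /w -(cosDz2pi (e%:~R * _ - t') be) /s /t /r.
  congr (_ * cos _ + _ * cos _); first by field; rewrite gt_eqF.
  rewrite [LHS](_ : _ = (p%:R * b%:R) * (2 * pi / q%:R) -
    (e%:~R * (r a' - r b') + t')); last by rewrite /r; ring.
  by rewrite eb_R /r; field; rewrite gt_eqF.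
have w_ab A s' B t' : w A (s + s') B (t + t') (a + b)%N =
    A * cos (r a + r b - s') + B * cos (e%:~R * (r a' - r b') - t').
  rewrite /w -(cosDz2pi (e%:~R * _ - t') (al + be)) /s /t /r.
  congr (_ * cos _ + _ * cos _); first by rewrite natrD; field; rewrite gt_eqF.
  rewrite [LHS](_ : _ = (p%:R * a%:R + p%:R * b%:R) * (2 * pi / q%:R) -
    (e%:~R * (r a' - r b') + t')); last by rewrite /r natrD; ring.
  by rewrite ea_R eb_R /r rmorphD; field; rewrite gt_eqF.
have w_top c : c \in [:: 0; a; b; a + b]%N -> w S s T t c = M.
  have -> : w S s T t c = w S (s + 0) T (t + 0) c by rewrite !addr0.
  rewrite !inE => /or4P[] /eqP ->;
    by rewrite ?w_0 ?w_a ?w_b ?w_ab !subr0 cose ?cosN.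
have w_le k : w S s T t k <= M.
  rewrite leNgt; apply/negP => lt; have [c hc kc] := hmax _ (ltW lt).
  have e1 := x_wave p q k S s T t; have e2 := x_wave p q c S s T t.
  move: lt; rewrite /w -e1 (x_modn p q k c q0 kc) e2 -/(w _ _ _ _ _) w_top//.
  by rewrite ltxx.
pose u := wave_col S s T t.
have xu k : (x k *m u) 0 0 = w S s T t k by apply: x_wave.
have u0 : u != 0.
  apply/eqP => e0; have /matrixP h := e0.
  have h0 := h 0 0; have h1 := h 1 0; rewrite !mxE /= in h0 h1.
  have : S * S * (cos s ^+ 2 + sin s ^+ 2) = 0.
    rewrite (_ : _ * _ = (S * cos s) ^+ 2 + (S * sin s) ^+ 2); last by ring.
    by rewrite h0 h1; ring.
  by rewrite cos2Dsin2 mulr1 => /eqP; rewrite mulf_eq0 gt_eqF.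
have vertexP y : [set x 0%N; x a; x b; x (a + b)%N] y <->
    exists2 c, c \in [:: 0; a; b; a + b]%N & y = x c.
  split=> [[[[->|->]|->]|->]|[c]].
  - by exists 0%N; rewrite ?inE.
  - by exists a; rewrite ?inE ?eqxx ?orbT.
  - by exists b; rewrite ?inE ?eqxx ?orbT.
  - by exists (a + b)%N; rewrite ?inE ?eqxx ?orbT.
  - rewrite !inE => /or4P[] /eqP -> ->;
      by [do 3 left|do 2 left; right|left; right|right].
have vertex_top y : [set x 0%N; x a; x b; x (a + b)%N] y -> (y *m u) 0 0 = M.
  by move=> /vertexP[c hc ->]; rewrite xu w_top.
have aff : affinely_independent (tnth [tuple x 0%N; x a; x b; x (a + b)%N]).
  apply: affinely_independentP => l hl.
  pose l1 := l 0; pose l2 := l (lift 0 0); pose l3 := l (lift 0 (lift 0 0)).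
  (* the shifts [s'] and [t'] by [pi / 2] turn the cosines into sines *)
  have lin A s' B t' :
     l1 * (w A (s + s') B (t + t') a - w A (s + s') B (t + t') 0%N)
     + l2 * (w A (s + s') B (t + t') b - w A (s + s') B (t + t') 0%N)
     + l3 * (w A (s + s') B (t + t') (a + b)%N - w A (s + s') B (t + t') 0%N)
     = 0.
    have := hl (wave_col A (s + s') B (t + t')).
    rewrite !big_ord_recl big_ord0 !(tnth_nth 0) /= !x_wave addr0 !addrA; exact.
  have [l10 l20 l30] : [/\ l1 = 0, l2 = 0 & l3 = 0].
    apply: (independent_phases (r a) (r b) (r a') (r b') S T) => //.
    - have := lin 1 0 0 0; rewrite w_0 w_a w_b w_ab !subr0 !cosN => <-.
      by clear; ring.
    - have := lin 1 (pi / 2) 0 0; rewrite w_0 w_a w_b w_ab !cosBpihalf !sinN => <-.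
      by clear; ring.
    - have e0 : e%:~R != 0 :> R by case: e_sign => ->.
      apply: (mulfI e0); rewrite mulr0.
      have := lin 0 0 1 (pi / 2).
      rewrite w_0 w_a w_b w_ab !cosBpihalf !sine !sinN => <-.
      by clear; ring.
  case=> [[|[|[|//]]] hi].
  - by rewrite -[RHS]l10; congr l; apply: val_inj.
  - by rewrite -[RHS]l20; congr l; apply: val_inj.
  - by rewrite -[RHS]l30; congr l; apply: val_inj.
split=> //.
- apply: (conv_hull_face _ _ u M) => //.
  + move=> y /vertexP[c hc ->]; exists c => //=; move: hc.
    by rewrite !inE => /or4P[] /eqP ->; clear -abq; lia.
  + by move=> _ [k _ <-]; rewrite xu w_le.
  + move=> _ [k _ <-]; rewrite xu => /eqP.
    rewrite eq_le => /andP[_ /hmax[c hc kc]].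
    by apply/vertexP; exists c => //; apply: x_modn.
- split.
    exists (tnth [tuple x 0%N; x a; x b; x (a + b)%N]); split=> // i.
    apply: sub_gen_smallest; apply/vertexP.
    have : tnth [tuple x 0%N; x a; x b; x (a + b)%N] i \in
        [tuple x 0%N; x a; x b; x (a + b)%N] by exact: mem_tnth.
    rewrite !inE => /or4P[] /eqP ->; first by exists 0%N; rewrite ?inE.
    + by exists a; rewrite ?inE ?eqxx ?orbT.
    + by exists b; rewrite ?inE ?eqxx ?orbT.
    + by exists (a + b)%N; rewrite ?inE ?eqxx ?orbT.
  apply: (hyperplane_dim _ u M) => //.
  exact: conv_hull_hyperplane.
Qed.

Theorem theorem1 (R : realType) (q p : nat)
  (hq : (5 <= q)%N) (hp : (2 <= p <= q - 2)%N) (hpq : coprime p q)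
  (alpha beta : int) (a b : nat) (ha : (1 <= a)%N) (hb : (1 <= b)%N)
  (hredA : coprimez alpha a) (hredB : coprimez beta b)
  (hA : 0 <= alpha%:Q / a%:Q <= 1) (hB : 0 <= beta%:Q / b%:Q <= 1)
  (hAB : farey_neighbors alpha a beta b)
  (hQ : strictly_between (p%:Q / q%:Q) (alpha%:Q / a%:Q) (beta%:Q / b%:Q))
  (hnQ : ~ (farey_neighbors alpha a p q /\ farey_neighbors beta b p q))
  (hninf : ~ (farey_neighbors alpha a 1 0 /\ farey_neighbors beta b 1 0)) :
  let x := @x_ R p q in
  let T := conv_hull [set x 0%N; x a; x b; x (a + b)%N] in
  [/\ is_face (Pi_ p q) T,
      has_dim 3 T &
      affinely_independent (tnth [tuple x 0%N; x a; x b; x (a + b)%N])].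
Proof.
have q0 : (0 < q)%N by lia.
have cross (u v : int) (m n : nat) : (0 < m)%N -> (0 < n)%N ->
    (u%:Q / m%:Q < v%:Q / n%:Q) = (u * n%:Z < v * m%:Z).
  move=> m0 n0; rewrite ltr_pdivrMr ?ltr0z// mulrAC ltr_pdivlMr ?ltr0z//.
  by rewrite -!intrM ltr_int.
have unit_itv (u : int) (m : nat) : (0 < m)%N -> 0 <= u%:Q / m%:Q <= 1 ->
    0 <= u <= m%:Z.
  move=> m0; rewrite ler_pdivlMr ?ltr0z// mul0r ler_pdivrMr ?ltr0z// mul1r.
  by rewrite ler0z ler_int.
have {}hA := unit_itv _ _ ha hA; have {}hB := unit_itv _ _ hb hB.
move: hQ hAB hnQ hninf; rewrite /strictly_between /farey_neighbors.
rewrite !cross// => hQ hAB hnQ hninf.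
have [e [a' [b' [he ea eb a'0 b'0]]]] : exists (e : int) (a' b' : nat),
    [/\ e = 1 \/ e = -1, p%:Z * a%:Z = alpha * q%:Z + e * a'%:Z,
     p%:Z * b%:Z = beta * q%:Z - e * b'%:Z, (0 < a')%N & (0 < b')%N].
  case/orP: hQ => /andP[h1 h2].
    exists 1, (absz (p%:Z * a%:Z - alpha * q%:Z)%R),
      (absz (beta * q%:Z - p%:Z * b%:Z)%R).
    by split; [left| | | |]; lia.
  exists (-1), (absz (alpha * q%:Z - p%:Z * a%:Z)%R),
    (absz (p%:Z * b%:Z - beta * q%:Z)%R).
  by split; [right| | | |]; lia.
have ee : e * e = 1 by case: he => ->.
have area : (a * b' + a' * b)%N = q.
  have h : a%:Z * b'%:Z + a'%:Z * b%:Z =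
      e * (beta * a%:Z - alpha * b%:Z) * q%:Z.
    have -> : a%:Z * b'%:Z + a'%:Z * b%:Z =
        e * (a%:Z * (e * b'%:Z) + (e * a'%:Z) * b%:Z).
      by rewrite -[LHS]mul1r -ee; ring.
    have -> : e * a'%:Z = p%:Z * a%:Z - alpha * q%:Z by lia.
    have -> : e * b'%:Z = beta * q%:Z - p%:Z * b%:Z by lia.
    by ring.
  have hs : e * (beta * a%:Z - alpha * b%:Z) = 1 \/
            e * (beta * a%:Z - alpha * b%:Z) = -1.
    by clear -he hAB; case: he => ->; lia.
  have pos : 0 < a%:Z * b'%:Z + a'%:Z * b%:Z by clear -a'0 b'0 ha hb; nia.
  by case: hs h => -> h; clear -h pos; lia.
(* a fraction of [0, 1] with denominator [1] is [0] or [1] *)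
have away (u : int) (m n : nat) : 0 <= u <= m%:Z ->
    `|u * q%:Z - p%:Z * m%:Z| = n%:Z -> ~ (m = 1%N /\ n = 1%N).
  move=> hu hn [em en]; move: hu hn; rewrite em en => hu.
  have [->|->] : u = 0 \/ u = 1 by lia.
    by lia.
  by lia.
apply: (tetrahedron_face p q a b a' b' e alpha beta) => //.
- by clear -hninf; lia.
- move=> [e1 e2]; apply: hnQ; rewrite e1 in ea; rewrite e2 in eb.
  by clear -ea eb he; case: he ea eb => -> ea eb; split; apply/eqP; lia.
- by apply: (away alpha) => //; clear -ea he; case: he ea => ->; lia.
- by apply: (away beta) => //; clear -eb he; case: he eb => ->; lia.
Qed.
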